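(* Let $N>2$, let $\lambda>0$, let $H$ be a real matrix with $N$ columns, let $y$ be a real vector of matching dimension, and let $a=(a_1,a_2)$. Let $\psi(\,\cdot\,;a)\colon\mathbb{R}^2\to\mathbb{R}$ be the bivariate penalty defined in the context from a univariate penalty $\phi$ satisfying properties P1–P10, and define $F\colon\mathbb{R}^N\to\mathbb{R}$ by $$F(x)=\tfrac12\|y-Hx\|_2^2+\frac{\lambda}{2}\sum_{n=1}^{N+1}\psi\big((x_{n-1},x_n);a\big),\qquad x_0:=0,\ x_{N+1}:=0.$$ Let $P$ be the $N\times N$ real symmetric tridiagonal Toeplitz matrix with all diagonal entries equal to $p_0$ and all sub- and super-diagonal entries equal to $p_1$, and suppose $0\preccurlyeq P\preccurlyeq H^{\mathsf T}H$. If $$0\le a_1\le (p_0+2p_1)/\lambda,\qquad 0\le a_2\le (p_0-2p_1)/\lambda,$$ then $F$ is convex.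
   Context: For symmetric matrices, $A\preccurlyeq B$ means that $B-A$ is positive semidefinite. Univariate penalty: a family of functions $\phi(\,\cdot\,;a)\colon \mathbb{R}\to\mathbb{R}$, indexed by $a \ge 0$, with the following properties for all $a\ge 0$ (derivatives $\phi',\phi''$ are with respect to $t$; $0^+$ denotes the right-hand limit at $0$): P1) $\phi(\,\cdot\,;a)$ is continuous on $\mathbb{R}$; P2) $\phi(\,\cdot\,;a)$ is twice continuously differentiable, increasing and concave on $\mathbb{R}_+ = (0,\infty)$; P3) $\phi(0;a)=0$; P4) $\phi(t;0)=|t|$; P5) $\phi(-t;a)=\phi(t;a)$; P6) $\phi'(0^+;a)=1$; P7) $\phi''(0^+;a)=-a$; P8) $\phi''(t;a)\ge -a$ for all $t\ne 0$; P9) for each $t$, $\phi(t;a)$ is decreasing (non-strictly) and convex in $a$; P10) $\phi(t;a) = (b/a)\,\phi(at/b;b)$ for all $a,b>0$. Define $s(t;a)=\phi(t;a)-|t|$. Bivariate function $S$: let $a=(a_1,a_2)$ with $a_i\ge 0$. If at least one $a_i$ is non-zero, put $\alpha = \frac{a_1+a_2}{2}$, $r=\frac{a_1-a_2}{a_1+a_2}$, and define $S(\,\cdot\,;a)\colon\mathbb{R}^2\to\mathbb{R}$ by $$S(x;a)=\begin{cases} s(x_1+rx_2;\alpha)+(1-r)\,s(x_2;a_1), & x\in A_1\\ s(rx_1+x_2;\alpha)+(1-r)\,s(x_1;a_1), & x\in A_2\\ s(rx_1+x_2;\alpha)+(1+r)\,s(x_1;a_2), & x\in A_3\\ s(x_1+rx_2;\alpha)+(1+r)\,s(x_2;a_2),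 & x\in A_4\end{cases}$$ where $A_1=\{x: x_2(x_1-x_2)\ge 0\}$, $A_2=\{x: x_1(x_1-x_2)\le 0\}$, $A_3=\{x: x_1(x_1+x_2)\le 0\}$, $A_4=\{x: x_2(x_1+x_2)\le 0\}$ (the formulas agree on overlaps). If $a_1=a_2=0$, $S(x;0)=0$. Bivariate penalty: $\psi(x;a)=S(x;a)+\|x\|_1$, where $\|x\|_1=|x_1|+|x_2|$. *)

(* Defs.v *)
(* MathComp-Analysis; the real line is an arbitrary [R : realType]. *)
From mathcomp Require Import all_boot all_order all_algebra.
From mathcomp Require Import all_classical all_reals all_analysis.
From mathcomp Require Import ring lra.

Set Implicit Arguments.
Unset Strict Implicit.
Unset Printing Implicit Defensive.

Import Order.TTheory GRing.Theory Num.Theory.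
Import numFieldNormedType.Exports.

Local Open Scope ring_scope.
Local Open Scope classical_set_scope.

(* [phi a t] is phi(t;a). The family is indexed by a >= 0; the values of
   [phi a] for a < 0 are unconstrained and never used. Monotonicity is
   non-strict, and concavity of f is convexity of - f. *)
Record univariate_penalty (R : realType) (phi : R -> R -> R) : Prop := {
  penalty_continuous : forall a : R, 0 <= a -> continuous (phi a) ;
  penalty_derivable : forall a : R, 0 <= a -> forall t : R, 0 < t ->
    derivable (phi a) t 1 ;
  penalty_derivable2 : forall a : R, 0 <= a -> forall t : R, 0 < t ->
    derivable (phi a)^`() t 1 ;
  penalty_continuous2 : forall a : R, 0 <= a -> forall t : R, 0 < t ->
    {for t, continuous (phi a)^`(2)} ;
  penalty_increasing : forall a : R, 0 <= a -> forall t u : R, 0 < t -> t <= u ->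
    phi a t <= phi a u ;
  penalty_concave : forall a : R, 0 <= a ->
    convex_function (`]0, +oo[%classic : set R) (fun t : R => - phi a t) ;
  penalty_at0 : forall a : R, 0 <= a -> phi a 0 = 0 ;
  penalty_index0 : forall t : R, phi 0 t = `|t| ;
  penalty_even : forall a : R, 0 <= a -> forall t : R, phi a (- t) = phi a t ;
  penalty_derive_0p : forall a : R, 0 <= a ->
    (phi a)^`() t @[t --> 0^'+] --> (1 : R) ;
  penalty_derive2_0p : forall a : R, 0 <= a ->
    (phi a)^`(2) t @[t --> 0^'+] --> - a ;
  penalty_derive2_ge : forall a : R, 0 <= a -> forall t : R, t != 0 ->
    - a <= (phi a)^`(2) t ;
  penalty_index_decreasing : forall t a b : R, 0 <= a -> a <= b ->
    phi b t <= phi a t ;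
  penalty_index_convex : forall t,
    convex_function (`[0, +oo[%classic : set R) (fun a : R => phi a t) ;
  penalty_scaling : forall a b : R, 0 < a -> 0 < b -> forall t,
    phi a t = b / a * phi b (a * t / b)
}.

Definition sfun (R : realType) (phi : R -> R -> R) (a t : R) : R :=
  phi a t - `|t|.

Definition regionA1 (R : realType) (x : R * R) : bool :=
  0 <= x.2 * (x.1 - x.2).
Definition regionA2 (R : realType) (x : R * R) : bool :=
  x.1 * (x.1 - x.2) <= 0.
Definition regionA3 (R : realType) (x : R * R) : bool :=
  x.1 * (x.1 + x.2) <= 0.
Definition regionA4 (R : realType) (x : R * R) : bool :=
  x.2 * (x.1 + x.2) <= 0.

(* The four regions cover the plane, so the last branch is taken only on A4;
   on overlaps the order of the tests is immaterial, see [Sbiv_regions]. *)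
Definition Sbiv (R : realType) (phi : R -> R -> R) (a x : R * R) : R :=
  let alpha := (a.1 + a.2) / 2 in
  let r := (a.1 - a.2) / (a.1 + a.2) in
  let s := sfun phi in
  if (a.1 == 0) && (a.2 == 0) then 0
  else if regionA1 x then s alpha (x.1 + r * x.2) + (1 - r) * s a.1 x.2
  else if regionA2 x then s alpha (r * x.1 + x.2) + (1 - r) * s a.1 x.1
  else if regionA3 x then s alpha (r * x.1 + x.2) + (1 + r) * s a.2 x.1
  else s alpha (x.1 + r * x.2) + (1 + r) * s a.2 x.2.

Definition norm1 (R : realType) (x : R * R) : R := `|x.1| + `|x.2|.

Definition psi (R : realType) (phi : R -> R -> R) (a x : R * R) : R :=
  Sbiv phi a x + norm1 x.

Lemma Sbiv_regions (R : realType) (phi : R -> R -> R) (a x : R * R)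
    (alpha := (a.1 + a.2) / 2) (r := (a.1 - a.2) / (a.1 + a.2))
    (s := sfun phi) :
  univariate_penalty phi -> 0 <= a.1 -> 0 <= a.2 ->
  ~~ ((a.1 == 0) && (a.2 == 0)) ->
  [/\ regionA1 x ->
        Sbiv phi a x = s alpha (x.1 + r * x.2) + (1 - r) * s a.1 x.2,
      regionA2 x ->
        Sbiv phi a x = s alpha (r * x.1 + x.2) + (1 - r) * s a.1 x.1,
      regionA3 x ->
        Sbiv phi a x = s alpha (r * x.1 + x.2) + (1 + r) * s a.2 x.1,
      regionA4 x ->
        Sbiv phi a x = s alpha (x.1 + r * x.2) + (1 + r) * s a.2 x.2 &
      [|| regionA1 x, regionA2 x, regionA3 x | regionA4 x]].
Proof.
move=> hphi a1 a2 an0; rewrite /Sbiv (negbTE an0) -/alpha -/r -/s.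
have al0 : 0 <= alpha by rewrite /alpha; lra.
have s0 b : 0 <= b -> s b 0 = 0.
  by move=> b0; rewrite /s /sfun (penalty_at0 hphi)// normr0 subrr.
have sN b t : 0 <= b -> s b (- t) = s b t.
  by move=> b0; rewrite /s /sfun (penalty_even hphi)// normrN.
have sq0 (u : R) : u ^+ 2 <= 0 -> u = 0.
  by move=> u0; apply/eqP; rewrite -sqrf_eq0 eq_le u0 sqr_ge0.
rewrite /regionA1 /regionA2 /regionA3 /regionA4.
case: x => x1 x2 /=; split.
- by move=> ->.
- move=> A2; case: ifP => A1; last by rewrite A2.
  have /subr0_eq -> : x1 - x2 = 0 by apply: sq0; rewrite expr2; lra.
  by congr (s _ _ + _); ring.
- move=> A3; case: ifP => A1.
    have sx1 := sqr_ge0 x1; have sx2 := sqr_ge0 x2.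
    rewrite !expr2 in sx1 sx2.
    have -> : x1 = 0 by apply: sq0; rewrite expr2; lra.
    have -> : x2 = 0 by apply: sq0; rewrite expr2; lra.
    by rewrite !(mulr0, addr0, s0).
  case: ifP => A2; last by rewrite A3.
  have -> : x1 = 0 by apply: sq0; rewrite expr2; lra.
  by rewrite !(mulr0, s0).
- move=> A4; case: ifP => A1.
    have -> : x2 = 0 by apply: sq0; rewrite expr2; lra.
    by rewrite !(mulr0, s0).
  case: ifP => A2.
    have sx1 := sqr_ge0 x1; have sx2 := sqr_ge0 x2.
    rewrite !expr2 in sx1 sx2.
    have -> : x1 = 0 by apply: sq0; rewrite expr2; lra.
    have -> : x2 = 0 by apply: sq0; rewrite expr2; lra.
    by rewrite !(mulr0, addr0, s0).
  case: ifP => A3 //.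
  have -> : x1 = - x2.
    by apply/eqP; rewrite -addr_eq0; apply/eqP; apply: sq0; rewrite expr2; lra.
  rewrite sN//; congr (_ + _); rewrite -sN//; congr (s _ _); ring.
- rewrite -[_ || _]negbK !negb_or -!ltNge; apply/negP => /and4P[*]; nra.
Qed.

Definition norm2 (R : realType) (n : nat) (v : 'cV[R]_n) : R :=
  Num.sqrt (\sum_(i < n) v i 0 ^+ 2).

(* For [x] with coordinates numbered from 1 to N as in the mathematics,
   [zext x n] is x_n, with x_n = 0 for n = 0 and n > N; the coordinate x_n is
   the entry of index n - 1 of the column [x]. *)
Definition zext (R : realType) (N : nat) (x : 'cV[R]_N) (n : nat) : R :=
  if n is k.+1 then oapp (fun i : 'I_N => x i 0) 0 (insub k) else 0.

Definition objective (R : realType) (phi : R -> R -> R) (lambda : R)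
    (a : R * R) (m N : nat) (H : 'M[R]_(m, N)) (y : 'cV[R]_m)
    (x : 'cV[R]_N) : R :=
  2^-1 * norm2 (y - H *m x) ^+ 2 +
  lambda / 2 * \sum_(1 <= n < N.+2) psi phi a (zext x n.-1, zext x n).

Definition psdmx (R : realType) (n : nat) (A : 'M[R]_n) : Prop :=
  A \is symmetricmx /\ forall u : 'cV[R]_n, 0 <= (u^T *m A *m u) 0 0.

Definition loewner_le (R : realType) (n : nat) (A B : 'M[R]_n) : Prop :=
  psdmx (B - A).

Definition tridiag_toeplitz (R : realType) (N : nat) (p0 p1 : R) : 'M[R]_N :=
  \matrix_(i, j) (if i == j then p0
                  else if (i.+1 == j :> nat) || (j.+1 == i :> nat) then p1
                  else 0).

(* Main.v *)
Require Import Defs.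
From mathcomp Require Import all_boot all_order all_algebra.
From mathcomp Require Import all_classical all_reals all_analysis.
From mathcomp Require Import ring lra.

Set Implicit Arguments.
Unset Strict Implicit.
Unset Printing Implicit Defensive.

Import Order.TTheory GRing.Theory Num.Theory.
Import numFieldNormedType.Exports.

Local Open Scope ring_scope.
Local Open Scope classical_set_scope.

(** Why the theorem is true.

    Write a1 = al (1 + r) and a2 = al (1 - r). On each of the four double cones
    that define it, S(x; a) is s(l x; al) plus a weighted s(m x; a_i) with l, m
    linear, and the quadratic form

      q(x) = a1/4 (x1 + x2)^2 + a2/4 (x1 - x2)^2

    splits along the same l and m: there q(x) = al/2 (l x)^2 + weight * a_i/2
    (m x)^2. Hence S + q is, cone by cone, a sum of functions
    k_a(t) = a/2 t^2 + s(t; a) of linear forms. Each k_a is convex, because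
    phi'' >= -a and because the slopes of phi(t; a) and |t| at 0+ agree, which
    makes k_a flat at the origin ([convexified_supported]).

    Convexity on each cone does not by itself give convexity on the plane; what
    glues the pieces is that their gradients agree on the common boundaries. The
    scaling law is what makes them agree: the slope of k_a at t is
    kappa(a t) for one odd function kappa, so the arguments match on the lines
    x1 = x2 and x1 = -x2. The gluing is done once and for all in
    [supported_glue]: a function that dominates its tangents on both sides of a
    hyperplane, for a single slope field, dominates them everywhere. Using it
    three times yields the convexity of S + q ([lifted_supported],
    [lifted_Sbiv]), so the Jensen gap of psi is at least minus that of q
    ([psi_jensen]).

    The data term compensates: its Jensen gap is that of a quadratic form
    dominating that of P ([residual_jensen]), and with zero boundary values
    w^T P w is the sum over consecutive pairs of
    (p0 + 2 p1)/4 (w_{n-1} + w_n)^2 + (p0 - 2 p1)/4 (w_{n-1} - w_n)^2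
    ([tridiag_toeplitz_form]). The bounds on a1 and a2 say exactly that each
    pair dominates lambda q. *)

(** * Gluing functions that dominate their tangents *)

Section SlopeFields.
Variables (R : realType) (V : lmodType R).
Implicit Types (D : set V) (f l : V -> R) (df : V -> V -> R).

Lemma scalar_scale f c v : scalar f -> f (c *: v) = c * f v.
Proof.
move=> flin; have f0 : f 0 = 0.
  by have := flin 1 0 0; rewrite scaler0 addr0 mul1r; lra.
by have := flin c v 0; rewrite f0 !addr0.
Qed.

Lemma scalar_sub f x y : scalar f -> f (y - x) = f y - f x.
Proof. by move=> flin; rewrite addrC -scaleN1r flin mulN1r addrC. Qed.

Lemma scalar_segment f x y t : scalar f ->
  f (x + t *: (y - x)) = f x + t * (f y - f x).
Proof. by move=> flin; rewrite addrC flin scalar_sub// addrC. Qed.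

(** The slope field [df] is explicit, and not merely an existing subgradient at
    each point, so that two pieces can be required to have the same slope where
    they meet: this is what replaces differentiability. *)
Definition supported D f df : Prop :=
  forall x y, D x -> D y -> f x + df x (y - x) <= f y.

(** Domination within [D1], used in both directions, makes the slope along the
    segment no smaller at the crossing point than at [x]; the tangent at the
    crossing point then carries the bound into [D2]. *)
Lemma supported_cross D1 D2 f df (x y : V) (t : R) :
  (forall z, scalar (df z)) -> 0 <= t <= 1 ->
  supported D1 f df -> supported D2 f df -> D1 x -> D2 y ->
  D1 (x + t *: (y - x)) -> D2 (x + t *: (y - x)) ->
  f x + df x (y - x) <= f y.
Proof.
move=> dflin /andP[]; rewrite le_eqVlt => /predU1P[<-|t0] t1 sD1 sD2 D1x D2y.
  by rewrite scale0r addr0 => _ D2x; exact: sD2.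
set w := y - x; set z := x + t *: w => D1z D2z.
have := sD1 x z D1x D1z; have := sD1 z x D1z D1x; have := sD2 z y D2z D2y.
have -> : z - x = t *: w by rewrite addrAC subrr add0r.
have -> : x - z = (- t) *: w by rewrite opprD addrA subrr add0r scaleNr.
have -> : y - z = (1 - t) *: w by rewrite scalerBl scale1r opprD addrA.
rewrite !scalar_scale// => zy zx xz.
have : t * (df z w - df x w) >= 0 by lra.
by rewrite pmulr_rge0//; nra.
Qed.

Lemma supported_glue D f df l :
  (forall z, scalar (df z)) -> scalar l ->
  (forall x y t, 0 <= t <= 1 -> D x -> D y -> D (x + t *: (y - x))) ->
  supported [set x | D x /\ 0 <= l x] f df ->
  supported [set x | D x /\ l x <= 0] f df ->
  supported D f df.
Proof.
move=> dflin llin Dconv spos sneg x y Dx Dy.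
(* The point of the segment from x to y where l vanishes. *)
pose t := l x / (l x - l y).
have cross : l x - l y != 0 -> l (x + t *: (y - x)) = 0.
  by move=> lxy; rewrite scalar_segment// /t; field.
have [lx|lx] := leP 0 (l x); have [ly|ly] := leP 0 (l y).
- exact: spos.
- have lxy : 0 < l x - l y by lra.
  have t01 : 0 <= t <= 1.
    by rewrite /t divr_ge0 ?(ltW lxy)//= ler_pdivrMr//; lra.
  by apply: (supported_cross dflin t01 spos sneg) => //=;
    rewrite ?cross ?lt0r_neq0//; split=> //; [exact: ltW|exact: Dconv..].
- have lxy : l x - l y < 0 by lra.
  have t01 : 0 <= t <= 1.
    by rewrite /t -mulrNN -invrN divr_ge0 ?ler_pdivrMr//; lra.
  by apply: (supported_cross dflin t01 sneg spos) => //=;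
    rewrite ?cross ?ltr0_neq0//; split=> //; [exact: ltW|exact: Dconv..].
- by apply: sneg; split=> //; exact: ltW.
Qed.

Lemma supported_eq D f g df dg :
  {in D, f =1 g} -> {in D, forall x, df x =1 dg x} ->
  supported D g dg -> supported D f df.
Proof.
move=> fg dfg sg x y Dx Dy.
by rewrite !fg ?dfg ?inE//; exact: sg.
Qed.

Lemma supported_jensen f df (x y : V) (t : R) :
  (forall z, scalar (df z)) -> 0 <= t <= 1 -> supported setT f df ->
  f (t *: x + (1 - t) *: y) <= t * f x + (1 - t) * f y.
Proof.
move=> dflin /andP[t0 t1] sf; set z := _ + _.
have := sf z x I I; have := sf z y I I.
have -> : x - z = (1 - t) *: (x - y).
  by rewrite /z opprD addrA -{1}[x]scale1r -scalerBl scalerBr.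
have -> : y - z = - t *: (x - y).
  rewrite /z scalerBl scale1r addrC opprD !opprB !addrA addrNK.
  by rewrite scalerBr !scaleNr opprK addrC.
by rewrite !scalar_scale//; nra.
Qed.

End SlopeFields.

(** * The quadratically corrected univariate penalty *)

Section UnivariatePenalty.
Variables (R : realType) (phi : R -> R -> R).
Hypothesis hphi : univariate_penalty phi.

Local Notation unit_derive := (derive1 (phi 1)).

Definition convexified (a t : R) : R := a / 2 * t ^+ 2 + Defs.sfun phi a t.

(** The derivative of [convexified 1]: for t > 0 it is t + phi'(t; 1) - 1, and
    the form with the sign is its odd extension, equal to 0 at 0. *)
Definition unit_slope (t : R) : R := t + Num.sg t * (unit_derive `|t| - 1).

Lemma unit_derive_is_derive (t : R) : 0 < t ->
  is_derive t (1 : R) (phi 1) (unit_derive t).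
Proof.
by move=> t0; rewrite derive1E; exact/derivableP/(penalty_derivable hphi).
Qed.

Lemma unit_derive_drop (u t : R) : 0 < u -> u <= t ->
  unit_derive u + u <= unit_derive t + t.
Proof.
move=> u0; rewrite le_eqVlt => /predU1P[->//|ut].
have gt0 x : x \in `[u, t]%R -> 0 < x.
  by rewrite in_itv/= => /andP[ux _]; exact: lt_le_trans u0 ux.
have [||c] := @MVT R unit_derive (derive1 unit_derive) u t ut.
- move=> x /subset_itv_oo_cc/gt0 x0; rewrite derive1E.
  exact/derivableP/(penalty_derivable2 hphi).
- by apply: derivable_within_continuous => x /gt0; exact: penalty_derivable2.
move=> /subset_itv_oo_cc/gt0 c0.
have := penalty_derive2_ge hphi ler01 (lt0r_neq0 c0).
by rewrite /derive1n/=; nra.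
Qed.

(** Let the smaller point of [unit_derive_drop] tend to 0+, where phi' tends
    to 1. *)
Lemma unit_derive_ge (t : R) : 0 < t -> 1 <= unit_derive t + t.
Proof.
move=> t0; apply: (cvgr_to_le (penalty_derive_0p hphi ler01)).
near=> s.
have s0 : 0 < s by near: s; exact: nbhs_right_gt.
have st : s <= t by near: s; apply: nbhs_right_le.
by have := unit_derive_drop s0 st; lra.
Unshelve. all: by end_near. Qed.

Lemma unit_slope_pos (t : R) : 0 < t -> unit_slope t = t - 1 + unit_derive t.
Proof. by move=> t0; rewrite /unit_slope gtr0_sg// gtr0_norm//; ring. Qed.

Lemma unit_slope0 : unit_slope 0 = 0.
Proof. by rewrite /unit_slope sgr0 mul0r addr0. Qed.

Lemma unit_slopeN (t : R) : unit_slope (- t) = - unit_slope t.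
Proof. by rewrite /unit_slope sgrN normrN mulNr opprD. Qed.

Lemma unit_slope_homo (u t : R) : 0 <= u -> u <= t ->
  unit_slope u <= unit_slope t.
Proof.
rewrite le_eqVlt => /predU1P[<-|u0] ut; last first.
  rewrite !unit_slope_pos ?(lt_le_trans u0 ut)//.
  by have := unit_derive_drop u0 ut; lra.
move: ut; rewrite unit_slope0 le_eqVlt => /predU1P[<-|t0].
  by rewrite unit_slope0.
by rewrite unit_slope_pos//; have := unit_derive_ge t0; lra.
Qed.

Lemma convexifiedN (a t : R) : 0 <= a -> convexified a (- t) = convexified a t.
Proof.
move=> a0; rewrite /convexified /Defs.sfun (penalty_even hphi)//.
by rewrite normrN sqrrN.
Qed.

Lemma convexified1_MVT (u t : R) : 0 <= u -> u < t ->
  exists2 c, u < c < t &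
    convexified 1 t - convexified 1 u = unit_slope c * (t - u).
Proof.
move=> u0 ut; have t0 := le_lt_trans u0 ut.
(* On [0, +oo) the absolute value is the identity, and f is differentiable. *)
pose f : R -> R := (fun x : R => 2^-1 *: x ^+ 2 - x) + phi 1.
have fE x : 0 <= x -> f x = convexified 1 x.
  move=> x0; rewrite /f/= /convexified /Defs.sfun ger0_norm//.
  by rewrite !fctE /GRing.scale/=; ring.
have [||c] := @MVT R f unit_slope u t ut.
- move=> x; rewrite in_itv/= => /andP[ux _]; have x0 := le_lt_trans u0 ux.
  have d1 := unit_derive_is_derive x0.
  rewrite unit_slope_pos//; apply: is_derive_eq.
  by rewrite /GRing.scale/=; field.
- have cf : continuous f.
    move=> x; apply: cvgD; last exact: (penalty_continuous hphi).
    by apply: cvgB; [apply: cvgZr; exact: exprn_continuous|exact: cvg_id].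
  exact: continuous_subspaceT.
rewrite in_itv/= => utc; rewrite !fE// ?(ltW t0)// => eq; by exists c.
Qed.

(** On the half-line this is the monotonicity of the slope. A tangent taken at
    u >= 0 has nonnegative slope, so at t < 0 it lies below its value at -t. *)
Lemma convexified1_supported (t u : R) :
  convexified 1 u + unit_slope u * (t - u) <= convexified 1 t.
Proof.
have main (x y : R) : 0 <= x -> 0 <= y ->
    convexified 1 x + unit_slope x * (y - x) <= convexified 1 y.
  move=> x0 y0; have [xy|yx|->] := ltgtP x y; last by lra.
    have [c /andP[xc cy] eq] := convexified1_MVT x0 xy.
    by have := unit_slope_homo x0 (ltW xc); nra.
  have [c /andP[yc cx] eq] := convexified1_MVT y0 yx.
  by have := unit_slope_homo (ltW (le_lt_trans y0 yc)) (ltW cx); nra.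
wlog u0 : t u / 0 <= u.
  move=> wl; have [|/ltW u0] := leP 0 u; first exact: wl.
  have := wl (- t) (- u); rewrite !convexifiedN// unit_slopeN oppr_ge0.
  by move=> /(_ u0); lra.
have [t0|/ltW t0] := leP 0 t; first exact: main.
have := main u (- t) u0; rewrite oppr_ge0 convexifiedN// => /(_ t0).
by have := unit_slope_homo (lexx _) u0; rewrite unit_slope0; nra.
Qed.

(** By the scaling law, [convexified a t] is [convexified 1 (a * t) / a]; so
    every index has its slopes given by the single function [unit_slope]. *)
Lemma convexified_supported (a t u : R) : 0 <= a ->
  convexified a u + unit_slope (a * u) * (t - u) <= convexified a t.
Proof.
rewrite le_eqVlt => /predU1P[<-|a0].
  rewrite /convexified /Defs.sfun !(penalty_index0 hphi) !mul0r unit_slope0.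
  by lra.
have scale x : convexified a x = a^-1 * convexified 1 (a * x).
  rewrite /convexified /Defs.sfun (penalty_scaling hphi a0 ltr01) divr1 normrM.
  rewrite (gtr0_norm a0); field; exact: lt0r_neq0.
rewrite !scale -(ler_pM2l a0) mulrDr !mulrA divff ?lt0r_neq0// !mul1r.
have := convexified1_supported (a * t) (a * u).
by congr (_ <= _); ring.
Qed.

Lemma convexified0 (a : R) : 0 <= a -> convexified a 0 = 0.
Proof.
move=> a0; rewrite /convexified /Defs.sfun (penalty_at0 hphi)// normr0; ring.
Qed.

Lemma convexified_ge0 (a t : R) : 0 <= a -> 0 <= convexified a t.
Proof.
move=> a0; have := convexified_supported t 0 a0.
by rewrite convexified0// mulr0 unit_slope0 mul0r addr0.
Qed.

End UnivariatePenalty.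

(** * Convexity of S plus its quadratic correction *)

Section BivariatePenalty.
Variables (R : realType) (phi : R -> R -> R).
Hypothesis hphi : univariate_penalty phi.
Variables al r : R.
Hypotheses (al0 : 0 <= al) (r_geN1 : -1 <= r) (r_le1 : r <= 1).

Local Notation V := (R^o * R^o)%type.
Local Notation k := (convexified phi).
Local Notation slope := (unit_slope phi).
Local Notation ap := (al * (1 + r)).
Local Notation am := (al * (1 - r)).

Let ap0 : 0 <= ap.
Proof. by apply: mulr_ge0 => //; move: r_geN1 r_le1; lra. Qed.
Let am0 : 0 <= am.
Proof. by apply: mulr_ge0 => //; move: r_geN1 r_le1; lra. Qed.

(** On a sector around a coordinate axis two of the four formulas for S are in
    force, one on each side of the axis; they share the term in [al], and [tail]
    joins their other terms into one function of the transversal coordinate. *)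
Definition tail (t : R) : R :=
  if 0 <= t then (1 - r) * k ap t else (1 + r) * k am t.

Definition tail_slope (t : R) : R :=
  if 0 <= t then (1 - r) * slope (ap * t) else (1 + r) * slope (am * t).

(** Both halves of [tail] are nonnegative and vanish at 0, where they have slope
    0: a tangent of one half is nonpositive on the other side of 0. *)
Lemma tail_supported (t u : R) :
  tail u + tail_slope u * (t - u) <= tail t.
Proof.
have half c a : 0 <= c -> 0 <= a -> forall x y,
    c * k a x + c * slope (a * x) * (y - x) <= c * k a y.
  move=> c0 a0 x y; rewrite -mulrA -mulrDr ler_wpM2l//.
  exact: convexified_supported.
have rp : 0 <= 1 + r by move: r_geN1; lra.
have rm : 0 <= 1 - r by move: r_le1; lra.
have k0 a (x : R) := convexified_ge0 hphi (a := a) x.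
have s0 a (x : R) : 0 <= a -> 0 <= x -> 0 <= slope (a * x).
  move=> a0 x0; rewrite -(unit_slope0 phi).
  by apply: (unit_slope_homo hphi) => //; exact: mulr_ge0.
rewrite /tail /tail_slope.
have [u0|/ltW u0] := leP 0 u; have [t0|/ltW t0] := leP 0 t.
- exact: half.
- have := half _ _ rm ap0 u 0; rewrite convexified0// mulr0.
  have : 0 <= (1 + r) * k am t by apply: mulr_ge0 => //; exact: k0.
  have : 0 <= (1 - r) * slope (ap * u) by apply: mulr_ge0 => //; exact: s0.
  by nra.
- have := half _ _ rp am0 u 0; rewrite convexified0// mulr0.
  have : 0 <= (1 - r) * k ap t by apply: mulr_ge0 => //; exact: k0.
  have : (1 + r) * slope (am * u) <= 0.
    rewrite -[u]opprK mulrN unit_slopeN mulrN oppr_le0 mulr_ge0//.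
    by apply: s0; rewrite ?oppr_ge0.
  by nra.
- exact: half.
Qed.

Lemma sector_supported (D : set V) (l m : V -> R) : scalar l -> scalar m ->
  supported D (fun x => k al (l x) + tail (m x))
    (fun x v => slope (al * l x) * l v + tail_slope (m x) * m v).
Proof.
move=> llin mlin x y _ _.
rewrite (scalar_sub x y llin) (scalar_sub x y mlin).
have := convexified_supported hphi (l y) (l x) al0.
by have := tail_supported (m y) (m x); lra.
Qed.

(** S(x; a) + a1/4 (x1 + x2)^2 + a2/4 (x1 - x2)^2, written on the four sectors
    cut out by the diagonals rather than on the regions A1 to A4. *)
Definition lifted (x : V) : R :=
  if 0 <= x.1 - x.2 then
    if 0 <= x.1 + x.2 then k al (x.1 + r * x.2) + tail x.2
    else k al (r * x.1 + x.2) + tail (- x.1)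
  else if 0 <= x.1 + x.2 then k al (r * x.1 + x.2) + tail x.1
  else k al (x.1 + r * x.2) + tail (- x.2).

Definition lifted_slope (x v : V) : R :=
  if 0 <= x.1 - x.2 then
    if 0 <= x.1 + x.2 then
      slope (al * (x.1 + r * x.2)) * (v.1 + r * v.2) + tail_slope x.2 * v.2
    else
      slope (al * (r * x.1 + x.2)) * (r * v.1 + v.2) +
      tail_slope (- x.1) * - v.1
  else if 0 <= x.1 + x.2 then
    slope (al * (r * x.1 + x.2)) * (r * v.1 + v.2) + tail_slope x.1 * v.1
  else
    slope (al * (x.1 + r * x.2)) * (v.1 + r * v.2) + tail_slope (- x.2) * - v.2.

Lemma tail_slope_pos (t : R) : 0 <= t ->
  tail_slope t = (1 - r) * slope (al * (t + r * t)).
Proof.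
move=> t0; rewrite /tail_slope t0; congr (_ * slope _); ring.
Qed.

Lemma tail_slope_neg (t : R) : t <= 0 ->
  tail_slope t = (1 + r) * slope (al * (t - r * t)).
Proof.
rewrite /tail_slope le_eqVlt => /predU1P[->|t0].
  by rewrite lexx !(mulr0, subr0) unit_slope0 !mulr0.
by rewrite leNgt t0/=; congr (_ * slope _); ring.
Qed.

(** The next four lemmas give value and slope on the closed sectors: that the
    formulas also hold on the shared edges is the matching of gradients. *)
Lemma lifted_right (x : V) : 0 <= x.1 - x.2 -> 0 <= x.1 + x.2 ->
  lifted x = k al (x.1 + r * x.2) + tail x.2 /\
  lifted_slope x =1 (fun v =>
    slope (al * (x.1 + r * x.2)) * (v.1 + r * v.2) + tail_slope x.2 * v.2).
Proof. by move=> d e; split=> [|v]; rewrite /lifted /lifted_slope d e. Qed.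

Lemma lifted_top (x : V) : x.1 - x.2 <= 0 -> 0 <= x.1 + x.2 ->
  lifted x = k al (r * x.1 + x.2) + tail x.1 /\
  lifted_slope x =1 (fun v =>
    slope (al * (r * x.1 + x.2)) * (r * v.1 + v.2) + tail_slope x.1 * v.1).
Proof.
move=> d e; rewrite /lifted /lifted_slope e; case: ifP => // d'.
have -> : x.2 = x.1 by lra.
have -> : r * x.1 + x.1 = x.1 + r * x.1 by ring.
by split=> [//|v]; rewrite tail_slope_pos; [ring|lra].
Qed.

Lemma lifted_bottom (x : V) : 0 <= x.1 - x.2 -> x.1 + x.2 <= 0 ->
  lifted x = k al (r * x.1 + x.2) + tail (- x.1) /\
  lifted_slope x =1 (fun v =>
    slope (al * (r * x.1 + x.2)) * (r * v.1 + v.2) +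
    tail_slope (- x.1) * - v.1).
Proof.
move=> d e; rewrite /lifted /lifted_slope d; case: ifP => // e'.
have -> : x.2 = - x.1 by lra.
have -> : r * x.1 + - x.1 = - x.1 - r * - x.1 by ring.
have -> : x.1 + r * - x.1 = - (- x.1 - r * - x.1) by ring.
split=> [|v]; first by rewrite convexifiedN.
by rewrite tail_slope_neg ?(mulrN al) ?unit_slopeN; [ring|lra].
Qed.

Lemma lifted_left (x : V) : x.1 - x.2 <= 0 -> x.1 + x.2 <= 0 ->
  lifted x = k al (x.1 + r * x.2) + tail (- x.2) /\
  lifted_slope x =1 (fun v =>
    slope (al * (x.1 + r * x.2)) * (v.1 + r * v.2) +
    tail_slope (- x.2) * - v.2).
Proof.
move=> d e; have [d'|d'] := leP 0 (x.1 - x.2).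
  have [-> dE] := lifted_bottom d' e; have x21 : x.2 = x.1 by lra.
  rewrite x21; have -> : r * x.1 + x.1 = x.1 + r * x.1 by ring.
  split=> [//|v]; rewrite dE x21 tail_slope_pos; last lra.
  have -> : r * x.1 + x.1 = x.1 + r * x.1 by ring.
  have -> : - x.1 + r * - x.1 = - (x.1 + r * x.1) by ring.
  by rewrite (mulrN al) unit_slopeN; ring.
have [e'|e'] := leP 0 (x.1 + x.2).
  have [-> dE] := lifted_top d e'; have x21 : x.2 = - x.1 by lra.
  rewrite x21 opprK; have -> : x.1 + r * - x.1 = x.1 - r * x.1 by ring.
  have argE : r * x.1 - x.1 = - (x.1 - r * x.1) by ring.
  split=> [|v]; first by rewrite argE convexifiedN.
  rewrite dE x21 argE tail_slope_neg; last lra.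
  by rewrite (mulrN al) unit_slopeN; ring.
by split=> [|v]; rewrite /lifted /lifted_slope !leNgt d' e'.
Qed.

Lemma lifted_slope_scalar x : scalar (lifted_slope x).
Proof.
move=> c u v; rewrite /lifted_slope /=.
have scE (p q : R^o) : c *: p + q = c * p + q :> R by [].
by rewrite !scE; case: ifP => _; case: ifP => _; ring.
Qed.

Lemma lifted_supported : supported [set: V] lifted lifted_slope.
Proof.
have flin (p q : R) : scalar (fun x : V => p * x.1 + q * x.2 : R).
  move=> c u v /=.
  have scE (s t : R^o) : c *: s + t = c * s + t :> R by [].
  by rewrite !scE; ring.
have flin' (f : V -> R) p q : f =1 (fun x => p * x.1 + q * x.2) -> scalar f.
  by move=> fE c u v; rewrite !fE; exact: flin.
have dlin : scalar (fun x : V => x.1 - x.2 : R).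
  by apply: (flin' _ 1 (-1)) => x; ring.
have elin : scalar (fun x : V => x.1 + x.2 : R).
  by apply: (flin' _ 1 1) => x; ring.
have llin : scalar (fun x : V => x.1 + r * x.2 : R).
  by apply: (flin' _ 1 r) => x; ring.
have llin' : scalar (fun x : V => r * x.1 + x.2 : R).
  by apply: (flin' _ r 1) => x; ring.
have m1 : scalar (fun x : V => x.1 : R) by apply: (flin' _ 1 0) => x; ring.
have m2 : scalar (fun x : V => x.2 : R) by apply: (flin' _ 0 1) => x; ring.
have m1N : scalar (fun x : V => - x.1 : R).
  by apply: (flin' _ (-1) 0) => x; ring.
have m2N : scalar (fun x : V => - x.2 : R).
  by apply: (flin' _ 0 (-1)) => x; ring.
(* Cut along x1 = x2, then each half-plane along x1 = -x2. *)
apply: (supported_glue lifted_slope_scalar dlin) => //.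
- apply: (supported_glue lifted_slope_scalar elin).
  + move=> x y t t01 [_ /= dx] [_ /= dy]; split => //.
    have /= -> := scalar_segment x y t dlin.
    case/andP: t01 => t0; rewrite -subr_ge0 => t1.
    by have := mulr_ge0 t0 dy; have := mulr_ge0 t1 dx; lra.
  + by apply: supported_eq (@sector_supported _ _ _ llin m2) => x;
      rewrite inE/= => -[[_ d] e]; have [] := lifted_right d e.
  + by apply: supported_eq (@sector_supported _ _ _ llin' m1N) => x;
      rewrite inE/= => -[[_ d] e]; have [] := lifted_bottom d e.
- apply: (supported_glue lifted_slope_scalar elin).
  + move=> x y t t01 [_ /= dx] [_ /= dy]; split => //.
    have /= -> := scalar_segment x y t dlin.
    case/andP: t01 => t0; rewrite -subr_ge0 => t1.
    by have := mulr_ge0_le0 t0 dy; have := mulr_ge0_le0 t1 dx; lra.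
  + by apply: supported_eq (@sector_supported _ _ _ llin' m1) => x;
      rewrite inE/= => -[[_ d] e]; have [] := lifted_top d e.
  + by apply: supported_eq (@sector_supported _ _ _ llin m2N) => x;
      rewrite inE/= => -[[_ d] e]; have [] := lifted_left d e.
Qed.

(** On each region, al/2 (l x)^2 + (1 -+ r) a_i/2 (m x)^2 is the same quadratic
    form, because al (1 - r) (1 + r) = (1 - r) a1 = (1 + r) a2. *)
Lemma lifted_Sbiv (x : V) :
  lifted x = Sbiv phi (ap, am) x +
             (ap / 4 * (x.1 + x.2) ^+ 2 + am / 4 * (x.1 - x.2) ^+ 2).
Proof.
have tail_pos t : 0 <= t -> tail t = (1 - r) * k ap t.
  by rewrite /tail => ->.
have tail_neg t : t <= 0 -> tail t = (1 + r) * k am t.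
  rewrite /tail le_eqVlt => /predU1P[->|]; last by rewrite leNgt => ->.
  by rewrite lexx !convexified0// !mulr0.
have [al_eq0|al_neq0] := eqVneq al 0.
  have k0 t : k 0 t = 0.
    by rewrite /convexified /Defs.sfun (penalty_index0 hphi); ring.
  rewrite /Sbiv /lifted /tail /= al_eq0 !mul0r eqxx/= !k0 !mulr0 !if_same.
  by ring.
have apm : ap + am = 2 * al by ring.
have alphaE : (ap + am) / 2 = al by rewrite apm; field.
have rE : (ap - am) / (ap + am) = r by rewrite apm; field.
have nz : ~~ ((ap == 0) && (am == 0)).
  apply/negP => /andP[/eqP p0 /eqP m0]; move: apm; rewrite p0 m0 addr0.
  by move/esym/eqP; rewrite mulf_eq0 pnatr_eq0 (negbTE al_neq0).
have [] := @Sbiv_regions _ phi (ap, am) x hphi ap0 am0 nz.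
rewrite /= alphaE rE /regionA1 /regionA2 /regionA3 /regionA4 => S1 S2 S3 S4 _.
have [d|/ltW d] := leP 0 (x.1 - x.2); have [e|/ltW e] := leP 0 (x.1 + x.2).
- have [-> _] := lifted_right d e.
  have [x2|/ltW x2] := leP 0 x.2.
    by rewrite S1 ?mulr_ge0// tail_pos// /convexified; field.
  by rewrite S4 ?mulr_le0_ge0// tail_neg// /convexified; field.
- have [-> _] := lifted_bottom d e.
  have [x1|/ltW x1] := leP 0 x.1.
    rewrite S3 ?mulr_ge0_le0// tail_neg ?oppr_le0//.
    by rewrite convexifiedN// /convexified; field.
  rewrite S2 ?mulr_le0_ge0// tail_pos ?oppr_ge0//.
  by rewrite convexifiedN// /convexified; field.
- have [-> _] := lifted_top d e.
  have [x1|/ltW x1] := leP 0 x.1.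
    by rewrite S2 ?mulr_ge0_le0// tail_pos// /convexified; field.
  by rewrite S3 ?mulr_le0_ge0// tail_neg// /convexified; field.
- have [-> _] := lifted_left d e.
  have [x2|/ltW x2] := leP 0 x.2.
    rewrite S4 ?mulr_ge0_le0// tail_neg ?oppr_le0//.
    by rewrite convexifiedN// /convexified; field.
  rewrite S1 ?mulr_le0// tail_pos ?oppr_ge0//.
  by rewrite convexifiedN// /convexified; field.
Qed.

End BivariatePenalty.

(** [psi] fails convexity by no more than the quadratic form of [lifted_Sbiv]:
    [psi] is a convex function minus that form, plus the 1-norm. *)
Lemma psi_jensen (R : realType) (phi : R -> R -> R) (a x y : R * R) (t : R) :
  univariate_penalty phi -> 0 <= a.1 -> 0 <= a.2 -> 0 <= t <= 1 ->
  psi phi a (t * x.1 + (1 - t) * y.1, t * x.2 + (1 - t) * y.2) <=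
  t * psi phi a x + (1 - t) * psi phi a y +
  t * (1 - t) * (a.1 / 4 * (x.1 - y.1 + (x.2 - y.2)) ^+ 2 +
                 a.2 / 4 * (x.1 - y.1 - (x.2 - y.2)) ^+ 2).
Proof.
case: a x y => [a1 a2] [x1 x2] [y1 y2] hphi /= a1_ge0 a2_ge0 t01.
pose al := (a1 + a2) / 2; pose r := (a1 - a2) / (a1 + a2).
have al0 : 0 <= al by rewrite /al; lra.
(* When a1 = a2 = 0 both al and r are 0, since 0^-1 = 0. *)
have [r_geN1 r_le1 a1E a2E] :
    [/\ -1 <= r, r <= 1, a1 = al * (1 + r) & a2 = al * (1 - r)].
  have [s0|s_neq0] := eqVneq (a1 + a2) 0.
    by rewrite /r /al s0 invr0 mulr0 !mul0r; split; lra.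
  have s_gt0 : 0 < a1 + a2 by rewrite lt0r s_neq0 addr_ge0.
  rewrite /r ler_pdivlMr// ler_pdivrMr// /al.
  by split; [lra|lra|field|field].
have lin := @lifted_slope_scalar R phi al r.
have := supported_jensen (x1, x2) (y1, y2) lin t01
  (lifted_supported hphi al0 r_geN1 r_le1).
rewrite !lifted_Sbiv// -a1E -a2E /psi /norm1 /=.
have absJ u v : `|t * u + (1 - t) * v| <= t * `|u| + (1 - t) * `|v|.
  case/andP: t01 => t0; rewrite -subr_ge0 => t1.
  by rewrite (le_trans (ler_normD _ _))// !normrM (ger0_norm t0) (ger0_norm t1).
have := absJ x1 y1; have := absJ x2 y2.
by rewrite /GRing.scale/=; lra.
Qed.

(** * The tridiagonal form and the data term *)

Section TridiagonalForm.
Variable R : realType.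

Lemma zext_ord N (x : 'cV[R]_N) (i : 'I_N) : zext x i.+1 = x i 0.
Proof. by rewrite /zext valK. Qed.

Lemma zext_last N (x : 'cV[R]_N) : zext x N.+1 = 0.
Proof. by rewrite /zext insubF// ltnn. Qed.

Lemma zext_comb N (x y : 'cV[R]_N) (s t : R) n :
  zext (s *: x + t *: y) n = s * zext x n + t * zext y n.
Proof.
case: n => [|n] /=; first by rewrite !mulr0 addr0.
by case: insub => [i|] /=; rewrite ?mxE// !mulr0 addr0.
Qed.

Lemma sum_zext N (x : 'cV[R]_N) n :
  \sum_(j < N) (if j == n :> nat then x j 0 else 0) = zext x n.+1.
Proof.
rewrite -big_mkcond /zext; case: insubP => [i _ iE|] /=.
  by rewrite (big_pred1 i)// => j; rewrite -iE.
rewrite -leqNgt => Nn; rewrite big1// => j /eqP jn.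
by move: (ltn_ord j); rewrite jn ltnNge Nn.
Qed.

Lemma mul_tridiag_toeplitz N (p0 p1 : R) (x : 'cV[R]_N) (i : 'I_N) :
  (tridiag_toeplitz N p0 p1 *m x) i 0 =
  p0 * zext x i.+1 + p1 * (zext x i + zext x i.+2).
Proof.
have predE : zext x i = \sum_(j < N) (if j.+1 == i :> nat then x j 0 else 0).
  case: (val i) => [|n]; last by rewrite -sum_zext.
  by rewrite big1.
rewrite predE -!sum_zext -big_split/= !mulr_sumr -big_split/= mxE.
apply: eq_bigr => j _; rewrite mxE -val_eqE/= [i.+1 == j]eq_sym.
rewrite [(i == j :> nat)]eq_sym.
case: (ltngtP j i) => [ji|ij|->].
- rewrite (ltn_eqF (ltnW ji : (j < i.+1)%N)).
  by case: eqP => _; rewrite ?(mul0r, mulr0, addr0, add0r).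
- rewrite (gtn_eqF (ltnW ij : (i < j.+1)%N)).
  by case: eqP => _; rewrite ?(mul0r, mulr0, addr0, add0r).
- by rewrite (ltn_eqF (ltnSn i)) (gtn_eqF (ltnSn i)) !addr0 mulr0 addr0.
Qed.

(** Summation by parts: each square z_n^2 and each product z_n z_(n+1) occurs
    twice, up to the boundary terms kept here so that induction applies. *)
Lemma sum_tridiag_pairs (p0 p1 : R) (z : nat -> R) N :
  \sum_(1 <= n < N.+2)
    (p0 / 2 * (z n.-1 ^+ 2 + z n ^+ 2) + 2 * p1 * (z n.-1 * z n)) =
  \sum_(i < N) z i.+1 * (p0 * z i.+1 + p1 * (z i + z i.+2)) +
  p0 / 2 * (z 0%N ^+ 2 + z N.+1 ^+ 2) +
  p1 * (z 0%N * z 1%N + z N * z N.+1).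
Proof.
elim: N => [|N IHN]; first by rewrite big_nat1 big_ord0/=; ring.
by rewrite big_nat_recr//= IHN big_ord_recr/=; field.
Qed.

(** The zero boundary values give the end coordinates the two neighbours that
    the diagonal entry p0 accounts for, whence a sum over pairs; on a pair the
    form is diagonal in the sum and the difference. *)
Lemma tridiag_toeplitz_form N (p0 p1 : R) (x : 'cV[R]_N) :
  (x^T *m tridiag_toeplitz N p0 p1 *m x) 0 0 =
  \sum_(1 <= n < N.+2)
    ((p0 + 2 * p1) / 4 * (zext x n.-1 + zext x n) ^+ 2 +
     (p0 - 2 * p1) / 4 * (zext x n.-1 - zext x n) ^+ 2).
Proof.
transitivity (\sum_(i < N) zext x i.+1 *
    (p0 * zext x i.+1 + p1 * (zext x i + zext x i.+2))).
  rewrite -mulmxA mxE; apply: eq_bigr => i _.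
  by rewrite mul_tridiag_toeplitz mxE zext_ord.
have := sum_tridiag_pairs p0 p1 (zext x) N.
rewrite zext_last /= expr0n !(mul0r, mulr0, addr0) => <-.
by apply: eq_bigr => n _; field.
Qed.

Lemma gram_form m N (H : 'M[R]_(m, N)) (x : 'cV[R]_N) :
  (x^T *m (H^T *m H) *m x) 0 0 = \sum_(i < m) ((H *m x) i 0) ^+ 2.
Proof.
rewrite mulmxA -trmx_mul -mulmxA mxE; apply: eq_bigr => i _.
by rewrite mxE expr2.
Qed.

Lemma norm2_sqr m (v : 'cV[R]_m) : norm2 v ^+ 2 = \sum_(i < m) v i 0 ^+ 2.
Proof. by rewrite sqr_sqrtr// sumr_ge0// => i _; exact: sqr_ge0. Qed.

Lemma residual_jensen m N (H : 'M[R]_(m, N)) (y : 'cV[R]_m)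
    (u v : 'cV[R]_N) (t : R) :
  norm2 (y - H *m (t *: u + (1 - t) *: v)) ^+ 2 =
  t * norm2 (y - H *m u) ^+ 2 + (1 - t) * norm2 (y - H *m v) ^+ 2 -
  t * (1 - t) * ((u - v)^T *m (H^T *m H) *m (u - v)) 0 0.
Proof.
rewrite gram_form !norm2_sqr !mulr_sumr -big_split -sumrB/=.
apply: eq_bigr => i _; rewrite mulmxDr mulmxBr -!scalemxAr !mxE.
by ring.
Qed.

End TridiagonalForm.

(** * Convexity of the objective *)

Theorem theorem4 (R : realType) (phi : R -> R -> R)
    (hphi : univariate_penalty phi)
    (m N : nat) (hN : (2 < N)%N) (lambda : R) (hlambda : 0 < lambda)
    (H : 'M[R]_(m, N)) (y : 'cV[R]_m) (a : R * R) (p0 p1 : R)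
    (hP0 : loewner_le 0 (tridiag_toeplitz N p0 p1))
    (hPH : loewner_le (tridiag_toeplitz N p0 p1) (H^T *m H))
    (ha1 : 0 <= a.1 <= (p0 + 2 * p1) / lambda)
    (ha2 : 0 <= a.2 <= (p0 - 2 * p1) / lambda) :
  convex_function [set: 'cV[R]_N] (objective phi lambda a H y).
Proof.
move=> t u v _ _; rewrite convRE.
have t01 : 0 <= t%:num <= 1 by rewrite ge0 le1.
have -> : conv t u v =
    t%:num *: (u : 'cV[R]_N) + (1 - t%:num) *: (v : 'cV[R]_N).
  by [].
rewrite /unstable.onem; move: t%:num t01 => s s01.
case/andP: ha1 => a1_ge0; rewrite ler_pdivlMr// => a1_le.
case/andP: ha2 => a2_ge0; rewrite ler_pdivlMr// => a2_le.
(* An opaque name, so that rewriting does not see through w to u - v. *)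
have [w wdef] : exists w : 'cV[R]_N, w = u - v by exists (u - v).
have data_gap : \sum_(1 <= n < N.+2) lambda *
      (a.1 / 4 * (zext w n.-1 + zext w n) ^+ 2 +
       a.2 / 4 * (zext w n.-1 - zext w n) ^+ 2) <=
    (w^T *m (H^T *m H) *m w) 0 0.
  have [_ /(_ w)] := hPH; rewrite mulmxBr mulmxBl mxE [X in _ + X]mxE subr_ge0.
  move=> /(le_trans _); apply; rewrite tridiag_toeplitz_form.
  apply: ler_sum => n _; have := sqr_ge0 (zext w n.-1 + zext w n).
  have := sqr_ge0 (zext w n.-1 - zext w n).
  by nra.
have reg_gap : \sum_(1 <= n < N.+2)
      psi phi a (zext (s *: u + (1 - s) *: v) n.-1,
                 zext (s *: u + (1 - s) *: v) n) <=
    s * (\sum_(1 <= n < N.+2) psi phi a (zext u n.-1, zext u n)) +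
    (1 - s) * (\sum_(1 <= n < N.+2) psi phi a (zext v n.-1, zext v n)) +
    s * (1 - s) * \sum_(1 <= n < N.+2)
      (a.1 / 4 * (zext w n.-1 + zext w n) ^+ 2 +
       a.2 / 4 * (zext w n.-1 - zext w n) ^+ 2).
  rewrite !mulr_sumr -!big_split/=.
  apply: ler_sum => n _; rewrite !zext_comb.
  have := psi_jensen (zext u n.-1, zext u n) (zext v n.-1, zext v n)
            hphi a1_ge0 a2_ge0 s01.
  have wE k : zext w k = zext u k - zext v k.
    by rewrite wdef -[u]scale1r -[- v]scaleN1r zext_comb scale1r mul1r mulN1r.
  by rewrite /= !wE.
rewrite -mulr_sumr in data_gap.
rewrite /objective residual_jensen -wdef.
have half_lambda_ge0 : 0 <= lambda / 2 by lra.
have s1s_ge0 : 0 <= s * (1 - s).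
  by case/andP: s01 => s0 s1; rewrite mulr_ge0 ?subr_ge0.
have := ler_wpM2l half_lambda_ge0 reg_gap.
have := ler_wpM2l s1s_ge0 data_gap.
by lra.
Qed.
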